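(* Let $A_1=P_1J_1P_1^{-1}$ with $J_1=\begin{pmatrix}-\alpha_1&\beta_1\\-\beta_1&-\alpha_1\end{pmatrix}$ and $A_2=P_2J_2P_2^{-1}$ with $J_2=\begin{pmatrix}\alpha_2&\beta_2\\-\beta_2&\alpha_2\end{pmatrix}$, where $\alpha_1,\alpha_2>0$ and $\beta_1,\beta_2\ne0$; here $P_1,P_2$ are real invertible $2\times 2$ matrices chosen such that $M=P_2^{-1}P_1=\begin{pmatrix}a&b\\c&d\end{pmatrix}$ has determinant $1$ or $-1$. Given $\eta>0$, let $$\tau_{1,2}(\eta)=\frac{\alpha_2}{\alpha_1}\eta+\frac1{\alpha_1}\cosh^{-1}\left(\frac{a^2+b^2+c^2+d^2}{2}\right).$$ Then the switched system $\dot x(t)=A_{\sigma(t)}x(t)$ is stable for all $\sigma\in\mathcal S[\tau_{1,2}(\eta),\eta]$ and asymptotically stable for all $\sigma\in\mathcal S'[\tau_{1,2}(\eta),\eta]$.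
   Context: Planar switched system: $\dot x(t)=A_{\sigma(t)}x(t)$, $x(t)\in\mathbb R^2$ continuous in $t\ge0$, with $A_1,A_2$ real $2\times2$ matrices. A switching signal $\sigma:[0,\infty)\to\{1,2\}$ is right-continuous and piecewise constant with infinitely many discontinuities $0<d_1<d_2<\cdots$, $d_k\to\infty$; set $d_0=0$. For a signal with $\sigma(0)=1$ put $t_k=d_{2k-1}-d_{2k-2}$ (times spent in $A_1$) and $s_k=d_{2k}-d_{2k-1}$ (times spent in $A_2$), $k\ge1$. For $\tau,\eta>0$, $\mathcal S[\tau,\eta]$ is the set of signals with $\sigma(0)=1$, $t_k\ge\tau$ and $s_k\le\eta$ for all $k\in\mathbb N$; $\mathcal S'[\tau,\eta]$ is the set of $\sigma\in\mathcal S[\tau,\eta]$ for which the sequence $(t_k,s_k)_{k\ge1}$ does not converge to $(\tau,\eta)$. For a given signal $\sigma$, the system is stable if for every $\varepsilon'>0$ there is $\delta>0$ such that $\|x(0)\|<\delta$ implies $\|x(t)\|<\varepsilon'$ for all $t>0$; it is asymptotically stable if it is stable and $\|x(t)\|\to0$ as $t\to\infty$ for every $x(0)\in\mathbb R^2$. Norms are Euclidean; $\cosh^{-1}:[1,\infty)\to[0,\infty)$. *)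

(* Defs.v *)
From HB Require Import structures.
From mathcomp Require Export all_boot all_order all_algebra.
From mathcomp Require Export all_classical all_reals all_analysis.
Export Order.TTheory GRing.Theory Num.Theory.
Export numFieldNormedType.Exports.

Set Implicit Arguments.
Unset Strict Implicit.
Unset Printing Implicit Defensive.

Local Open Scope classical_set_scope.
Local Open Scope ring_scope.

Definition mx22 (R : realType) (a b c d : R) : 'M[R]_2 :=
  \matrix_(i < 2, j < 2)
    if i == 0 then (if j == 0 then a else b) else (if j == 0 then c else d).

(* The library's norm on matrices is the sup norm, hence this definition. *)
Definition enorm (R : realType) (v : 'cV[R]_2) : R :=
  Num.sqrt (\sum_(i < 2) v i 0 ^+ 2).

Definition cosh (R : realType) (x : R) : R := (expR x + expR (- x)) / 2.

(* Inverse of cosh as a map [1, +oo[ -> [0, +oo[; unspecified below 1. *)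
Definition arcosh (R : realType) (y : R) : R :=
  get [set x : R | 0 <= x /\ cosh x = y].

Inductive mode := mode1 | mode2.

Definition subsystem (R : realType) (A1 A2 : 'M[R]_2) (m : mode) : 'M[R]_2 :=
  match m with mode1 => A1 | mode2 => A2 end.

(* sigma is right-continuous and piecewise constant on [0, +oo[, and its
   discontinuities are exactly d 1 < d 2 < ... (d 0 = 0 is not one of them).
   Such a d is determined by sigma. The values of sigma on ]-oo, 0[ are
   irrelevant everywhere below. *)
Definition switching_times (R : realType) (sigma : R -> mode) (d : nat -> R)
    : Prop :=
  [/\ d 0%N = 0,
      increasing_seq d,
      d @ \oo --> +oo,
      forall k t, d k <= t < d k.+1 -> sigma t = sigma (d k) &
      forall k, sigma (d k.+1) <> sigma (d k)].

(* Indices are shifted by one: on1 d k and on2 d k, for k >= 0, are the times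
   t_{k+1} and s_{k+1} spent in A_1 and A_2 during the (k+1)-st cycle. *)
Definition on1 (R : realType) (d : nat -> R) (k : nat) : R :=
  d (2 * k).+1 - d (2 * k)%N.

Definition on2 (R : realType) (d : nat -> R) (k : nat) : R :=
  d (2 * k).+2 - d (2 * k).+1.

Definition signals (R : realType) (tau eta : R) : set (R -> mode) :=
  [set sigma | sigma 0 = mode1 /\
    exists2 d, switching_times sigma d &
      forall k, tau <= on1 d k /\ on2 d k <= eta].

(* The d below is the one occurring in signals, by uniqueness of the switching
   times. *)
Definition signals' (R : realType) (tau eta : R) : set (R -> mode) :=
  [set sigma | signals tau eta sigma /\
    exists2 d, switching_times sigma d &
      ~ ((on1 d k, on2 d k) @[k --> \oo] --> (tau, eta))].

(* The differential equation is required at the positive times at which sigma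
   is continuous, i.e., locally constant. *)
Definition solution (R : realType) (A : mode -> 'M[R]_2) (sigma : R -> mode)
    (x : R -> 'cV[R]_2) : Prop :=
  {within `[0, +oo[, continuous x} /\
  forall t : R, 0 < t -> (\forall s \near t, sigma s = sigma t) ->
    is_derive t 1 x (A (sigma t) *m x t).

Definition stable (R : realType) (A : mode -> 'M[R]_2) (sigma : R -> mode)
    : Prop :=
  forall eps : R, 0 < eps -> exists2 delta : R, 0 < delta &
    forall x, solution A sigma x -> enorm (x 0) < delta ->
      forall t, 0 < t -> enorm (x t) < eps.

Definition asymptotically_stable (R : realType) (A : mode -> 'M[R]_2)
    (sigma : R -> mode) : Prop :=
  stable A sigma /\
  forall x, solution A sigma x -> enorm (x t) @[t --> +oo] --> 0.

(* a, b, c, d are the entries of the transition matrix P_2^-1 P_1. *)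
Definition tau12 (R : realType) (alpha1 alpha2 a b c d eta : R) : R :=
  alpha2 / alpha1 * eta
  + alpha1^-1 * arcosh ((a ^+ 2 + b ^+ 2 + c ^+ 2 + d ^+ 2) / 2).

(* Main.v *)
From mathcomp Require Import ring lra.
Require Import Defs.

(** In the coordinates y = P1^-1 x the first subsystem is a rotation combined
with the scaling exp (- alpha1 t), so |P1^-1 x| is multiplied by exactly that
factor while A1 is active; likewise |P2^-1 x| is multiplied by
exp (alpha2 t) while A2 is active ([energy_exp]).  Passing from one norm to the
other means applying M or M^-1, where M = P2^-1 P1.  As det M = 1 or -1, the
singular values of M are rho and 1/rho for some rho >= 1, with
rho^2 + rho^-2 = a^2 + b^2 + c^2 + d^2.  Hence
h := arcosh ((a^2 + b^2 + c^2 + d^2) / 2) satisfies exp h = rho^2, and the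
squared norms |P1^-1 x|^2 and |P2^-1 x|^2 differ by a factor of at most exp h, in either
direction ([energy_transition_le]).

Over a full cycle, |P1^-1 x|^2 is therefore multiplied by at most
exp (2 h + 2 alpha2 s_k - 2 alpha1 t_k).  Since alpha1 tau = alpha2 eta + h,
this is exp (- 2 w_k) where
w_k = alpha1 (t_k - tau) + alpha2 (eta - s_k) >= 0 ([cycle_energy]), and within
a cycle the growth is at most exp (2 (h + alpha2 eta)).  This gives stability.

If (t_k, s_k) does not converge to (tau, eta), then w_k is at least some
positive constant for infinitely many k ([slack_frequently_ge]), so that the
nonincreasing sequence of the values of |P1^-1 x|^2 at the starts of the cycles
is infinitely often multiplied by at most a fixed q < 1 and must tend to 0
([cvg0_contraction]).  This gives asymptotic stability. *)

Set Implicit Arguments.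
Unset Strict Implicit.
Unset Printing Implicit Defensive.

Local Open Scope classical_set_scope.
Local Open Scope ring_scope.

(** * Squared Euclidean norms in adapted coordinates *)

Lemma sum_ord2 (V : nmodType) (F : 'I_2 -> V) : \sum_(i < 2) F i = F 0 + F 1.
Proof.
rewrite 2!big_ord_recl big_ord0 addr0; congr (_ + F _); exact: val_inj.
Qed.

Definition sqnorm (R : realType) (v : 'cV[R]_2) : R := \sum_(i < 2) v i 0 ^+ 2.

(** The square of the norm in which the flow of P J P^-1, for J a scaled rotation,
is a pure scaling. *)
Definition energy (R : realType) (P : 'M[R]_2) (v : 'cV[R]_2) : R :=
  sqnorm (invmx P *m v).

Lemma sqnormE (R : realType) (v : 'cV[R]_2) :
  sqnorm v = v 0 0 ^+ 2 + v 1 0 ^+ 2.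
Proof. exact: sum_ord2. Qed.

Lemma sqnorm_ge0 (R : realType) (v : 'cV[R]_2) : 0 <= sqnorm v.
Proof. by apply: sumr_ge0 => i _; exact: sqr_ge0. Qed.

Lemma enorm_sq (R : realType) (v : 'cV[R]_2) : enorm v ^+ 2 = sqnorm v.
Proof. by rewrite sqr_sqrtr ?sqnorm_ge0. Qed.

(** Cauchy-Schwarz: K exceeds the squared Frobenius norm of Q, the added 1 making
it positive even for Q = 0. *)
Lemma sqnorm_mulmx_le (R : realType) (Q : 'M[R]_2) :
  exists2 K, 0 < K & forall v, sqnorm (Q *m v) <= K * sqnorm v.
Proof.
exists (\sum_(i < 2) \sum_(j < 2) Q i j ^+ 2 + 1).
  rewrite ltr_wpDl// sumr_ge0// => i _; rewrite sumr_ge0// => j _.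
  exact: sqr_ge0.
move=> v; rewrite !sqnormE !mxE !sum_ord2.
set x := v 0 0; set y := v 1 0.
set p := Q 0 0; set q := Q 0 1; set r := Q 1 0; set s := Q 1 1.
have := sqr_ge0 (p * y - q * x); have := sqr_ge0 (r * y - s * x).
have := sqr_ge0 x; have := sqr_ge0 y.
nra.
Qed.

Lemma energy_equiv (R : realType) (P : 'M[R]_2) : P \in unitmx ->
  exists2 K, 0 < K & forall v,
    enorm v ^+ 2 <= K * energy P v /\ energy P v <= K * enorm v ^+ 2.
Proof.
move=> Pu; have [K1 K1_gt0 E1] := sqnorm_mulmx_le P.
have [K2 K2_gt0 E2] := sqnorm_mulmx_le (invmx P).
exists (K1 + K2) => [|v]; first exact: addr_gt0.
rewrite enorm_sq; split.
  have := E1 (invmx P *m v); rewrite mulmxA mulmxV// mul1mx => /le_trans; apply.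
  by rewrite ler_wpM2r ?sqnorm_ge0// lerDl ltW.
by apply: (le_trans (E2 v)); rewrite ler_wpM2r ?sqnorm_ge0// lerDr ltW.
Qed.

(** * Comparison of the two energies *)

(** With M the matrix of rows (a, b) and (c, d), the symmetric matrix
l I - M^T M is positive semidefinite: its trace is l - l^-1 >= 0, and its
determinant l^2 - l tr (M^T M) + (det M)^2 vanishes by the choice of l, which is
thus the larger eigenvalue of M^T M. *)
Lemma det1_form_le (R : realType) (a b c d l x y : R) :
  (a * d - b * c) ^+ 2 = 1 -> 1 <= l ->
  l + l^-1 = a ^+ 2 + b ^+ 2 + c ^+ 2 + d ^+ 2 ->
  (a * x + b * y) ^+ 2 + (c * x + d * y) ^+ 2 <= l * (x ^+ 2 + y ^+ 2).
Proof.
move=> det1 l1 trE.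
have l0 : l != 0 by rewrite gt_eqF// (lt_le_trans ltr01).
have invl1 : l^-1 <= 1 by rewrite invf_le1// (lt_le_trans ltr01).
set p := l - a ^+ 2 - c ^+ 2; set r := l - b ^+ 2 - d ^+ 2.
set q := a * b + c * d.
have prE : p * r = q ^+ 2.
  have : l * (l + l^-1) = l ^+ 2 + 1 by rewrite mulrDr mulfV// expr2.
  rewrite trE /p /r /q => llE; nra.
have pr0 : 0 <= p + r by rewrite /p /r; lra.
suff : 0 <= p * x ^+ 2 - 2 * q * x * y + r * y ^+ 2 by rewrite /p /q /r; nra.
have [pr|] := ltP 0 (p + r).
  (* multiplied by the trace p + r of a singular matrix, the form is a sum of
     squares *)
  rewrite -(pmulr_rge0 _ pr).
  have -> : (p + r) * (p * x ^+ 2 - 2 * q * x * y + r * y ^+ 2)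
     = (p * x - q * y) ^+ 2 + (r * y - q * x) ^+ 2
       + (p * r - q ^+ 2) * (x ^+ 2 + y ^+ 2) by ring.
  by rewrite prE subrr mul0r addr0 addr_ge0 ?sqr_ge0.
move=> pr; have rE : r = - p by lra.
have := sqr_ge0 p; have := sqr_ge0 q; move: prE; rewrite rE mulrN -expr2 => E q2 p2.
have /eqP : p ^+ 2 = 0 by lra.
have /eqP : q ^+ 2 = 0 by lra.
by rewrite !sqrf_eq0 => /eqP -> /eqP ->; rewrite oppr0 mulr0 !mul0r !addr0 oppr0.
Qed.

(** The preimage is the classical ln (y + sqrt (y^2 - 1)); it shows that the
choice made in the definition of arcosh is a meaningful one. *)
Lemma arcoshP (R : realType) (y : R) : 1 <= y ->
  0 <= arcosh y /\ cosh (arcosh y) = y.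
Proof.
move=> y1; suff /getPex : exists x : R, 0 <= x /\ cosh x = y by [].
have y2 : 0 <= y ^+ 2 - 1 by rewrite subr_ge0 expr_ge1// (le_trans ler01).
have s2 := sqr_sqrtr y2; set s := Num.sqrt _ in s2.
have s0 : 0 <= s by exact: sqrtr_ge0.
have ys : y + s \is Num.pos by rewrite posrE; lra.
exists (ln (y + s)); split; first by rewrite ln_ge0//; lra.
rewrite /cosh expRN lnK//.
have -> : (y + s)^-1 = y - s.
  apply: (mulfI (x := y + s)); first by rewrite gt_eqF// -posrE.
  rewrite mulfV ?gt_eqF// -?posrE//.
  by rewrite mulrC -subr_sqr s2; ring.
by field.
Qed.

Lemma det_mx22 (R : realType) (a b c d : R) : \det (mx22 a b c d) = a * d - b * c.
Proof.
rewrite (expand_det_row _ 0) sum_ord2 /cofactor !det_mx11 !mxE/=.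
by rewrite expr0 expr1 mul1r mulN1r mulrN.
Qed.

(** The transition matrix sends the P1-coordinates of a vector to its
P2-coordinates.  A matrix of determinant 1 or -1 and its inverse have the same
largest singular value, which makes the comparison symmetric. *)
Lemma energy_transition_le (R : realType) (P1 P2 : 'M[R]_2) (a b c d : R) :
  P1 \in unitmx -> invmx P2 *m P1 = mx22 a b c d ->
  \det (mx22 a b c d) ^+ 2 = 1 ->
  let h := arcosh ((a ^+ 2 + b ^+ 2 + c ^+ 2 + d ^+ 2) / 2) in
  [/\ 0 <= h,
      forall v, energy P1 v <= expR h * energy P2 v &
      forall v, energy P2 v <= expR h * energy P1 v].
Proof.
move=> P1u ME; rewrite det_mx22 => det1.
set N := _ + _ + _ + _ => h.
have N2 : 1 <= N / 2.
  have := sqr_ge0 (a - d); have := sqr_ge0 (b + c).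
  have := sqr_ge0 (a + d); have := sqr_ge0 (b - c).
  have /eqP : (a * d - b * c) ^+ 2 = 1 by [].
  by rewrite sqrf_eq1 /N => /orP[] /eqP; nra.
have [h0] := arcoshP N2; rewrite -/h /cosh expRN => hN.
have trE : expR h + (expR h)^-1 = N by lra.
have l1 : 1 <= expR h by rewrite -expR0 ler_expR.
have zE v : let y := invmx P1 *m v in
    energy P1 v = y 0 0 ^+ 2 + y 1 0 ^+ 2 /\
    energy P2 v = (a * y 0 0 + b * y 1 0) ^+ 2 + (c * y 0 0 + d * y 1 0) ^+ 2.
  move=> y; split; first by rewrite /energy sqnormE.
  have -> : energy P2 v = sqnorm (mx22 a b c d *m y).
    by rewrite -ME /y mulmxA mulmxK.
  by rewrite sqnormE; clearbody y; rewrite !mxE !sum_ord2 !mxE.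
split=> // v; have [-> ->] := zE v; set y := _ *m v.
  set p := y 0 0; set q := y 1 0.
  (* the adjugate of the transition matrix, which is its inverse up to sign, has
     the same Frobenius norm and the same determinant *)
  have := @det1_form_le R d (- b) (- c) a (expR h) (a * p + b * q) (c * p + d * q).
  have -> : d * a - - b * - c = a * d - b * c by ring.
  have -> : d ^+ 2 + (- b) ^+ 2 + (- c) ^+ 2 + a ^+ 2 = N by rewrite /N; ring.
  move=> /(_ det1 l1 trE) adj_le; apply: le_trans adj_le.
  have -> : (d * (a * p + b * q) + - b * (c * p + d * q)) ^+ 2 +
     (- c * (a * p + b * q) + a * (c * p + d * q)) ^+ 2 =
     (a * d - b * c) ^+ 2 * (p ^+ 2 + q ^+ 2) by ring.
  by rewrite det1 mul1r.
exact: det1_form_le.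
Qed.

(** * Energy along one subsystem *)

Lemma is_derive_mulmx_coord (R : realType) (Q : 'M[R]_2) (x : R -> 'cV[R]_2)
    (dx : 'cV[R]_2) (t : R) (i : 'I_2) :
  is_derive t 1 x dx ->
  is_derive t 1 (fun s => (Q *m x s) i 0) ((Q *m dx) i 0).
Proof.
move=> [dvx dE].
have coord j : is_derive t 1 (fun s => x s j 0) (dx j 0).
  split; first by move/derivable_mxP : dvx; exact.
  by rewrite -dE derive_mx// mxE.
have -> : (fun s => (Q *m x s) i 0) = \sum_(j < 2) (Q i j \*: (fun s => x s j 0)).
  by apply/funext => s; rewrite mxE fct_sumE.
rewrite mxE; apply: is_derive_sum => j.
Qed.

Lemma continuous_energy (R : realType) (P : 'M[R]_2) : continuous (energy P).
Proof.
have cM := @continuousM R ('cV[R]_2 : topologicalType).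
have cD := @continuousD R R ('cV[R]_2 : topologicalType).
have coord i v : {for v, continuous (fun v : 'cV[R]_2 => (invmx P *m v) i 0)}.
  have -> : (fun v : 'cV[R]_2 => (invmx P *m v) i 0) =
      (fun v => invmx P i 0 * v 0 0 + invmx P i 1 * v 1 0).
    by apply/funext => w; rewrite mxE sum_ord2.
  have term j : {for v, continuous (fun v : 'cV[R]_2 => invmx P i j * v j 0)}.
    apply: (cM (fun=> invmx P i j) (fun v => v j 0)); first exact: cst_continuous.
    exact: coord_continuous.
  exact: cD (term 0) (term 1).
have -> : energy P = (fun v => (invmx P *m v) 0 0 ^+ 2 + (invmx P *m v) 1 0 ^+ 2).
  by apply/funext => v; rewrite /energy sqnormE.
move=> v; exact: cD (cM _ _ _ (coord 0 v) (coord 0 v))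
                    (cM _ _ _ (coord 1 v) (coord 1 v)).
Qed.

(** For a planar rotation with growth rate r, the rotational terms cancel in the
derivative of the squared norm, which grows at the rate 2 r. *)
Lemma is_derive_spiral (R : realType) (r beta u s : R) (p q : R -> R) :
  is_derive s 1 p (r * p s + beta * q s) ->
  is_derive s 1 q (- beta * p s + r * q s) ->
  is_derive s 1 (fun z => expR (- (2 * r) * (z - u)) * (p z ^+ 2 + q z ^+ 2)) 0.
Proof.
move=> dp dq; set k := - (2 * r).
have de : is_derive s 1 (fun z => expR (k * (z - u))) (expR (k * (s - u)) * k).
  apply: is_derive1_comp.
  have : is_derive s 1 (k \*: (fun z => z - u)) (k *: (1 - 0)).
    exact: is_deriveZ.
  by rewrite subr0 [_ *: _]mulr1.
have := is_deriveM de (is_deriveD (is_deriveX 2 dp) (is_deriveX 2 dq)).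
have -> : (fun z => expR (k * (z - u))) * (p ^+ 2 + q ^+ 2) =
    (fun z => expR (k * (z - u)) * (p z ^+ 2 + q z ^+ 2)) by [].
move=> df; apply: (is_derive_eq df).
by rewrite /k /GRing.scale/= !fctE /=; ring.
Qed.

(** The solution is only assumed differentiable inside the interval, because
the derivative jumps at the switching times; the mean value theorem applied to
exp (- 2 r (t - u)) times the energy needs no more. *)
Lemma energy_exp (R : realType) (P A : 'M[R]_2) (r beta u w : R)
    (x : R -> 'cV[R]_2) :
  P \in unitmx -> A = P *m mx22 r beta (- beta) r *m invmx P ->
  {within `[u, w], continuous x} ->
  (forall t, u < t < w -> is_derive t 1 x (A *m x t)) ->
  forall t, u <= t <= w ->
  energy P (x t) = expR (2 * r * (t - u)) * energy P (x u).
Proof.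
move=> Pu AE cx dx t /andP[ut tw].
pose f (s : R) := expR (- (2 * r) * (s - u)) * energy P (x s).
have df s : s \in `]u, t[ -> is_derive s 1 f 0.
  rewrite in_itv/= => /andP[us st].
  have usw : u < s < w by rewrite us (lt_le_trans st tw).
  have dy i := is_derive_mulmx_coord (invmx P) i (dx s usw).
  have QA : invmx P *m (A *m x s) = mx22 r beta (- beta) r *m (invmx P *m x s).
    by rewrite AE !mulmxA mulVmx// mul1mx.
  have JE (v : 'cV[R]_2) :
      (mx22 r beta (- beta) r *m v) 0 0 = r * v 0 0 + beta * v 1 0
      /\ (mx22 r beta (- beta) r *m v) 1 0 = - beta * v 0 0 + r * v 1 0.
    by rewrite !mxE !sum_ord2 !mxE.
  have d0 := dy 0; have d1 := dy 1.
  rewrite QA (JE _).1 in d0; rewrite QA (JE _).2 in d1.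
  have := is_derive_spiral u d0 d1.
  have -> // : (fun z => expR (- (2 * r) * (z - u)) *
    ((invmx P *m x z) 0 0 ^+ 2 + (invmx P *m x z) 1 0 ^+ 2)) = f.
  by apply/funext => z; rewrite /f /energy sqnormE.
have cf : {within `[u, t], continuous f}.
  have sub : `[u, t]%classic `<=` `[u, w]%classic.
    by apply: subset_itvl; rewrite bnd_simp.
  have ce : {within `[u, t], continuous (fun s => expR (- (2 * r) * (s - u)))}.
    apply: continuous_subspaceT => s.
    apply: continuous_comp; last exact: continuous_expR.
    by apply: cvgM; [exact: cvg_cst|apply: cvgB; [exact: cvg_id|exact: cvg_cst]].
  have cE : {within `[u, t], continuous (energy P \o x)}.
    apply: within_continuous_comp; last exact: continuous_subspaceW cx.
    by move=> v _; exact: continuous_energy.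
  by move=> s; exact: cvgM (ce s) (cE s).
have [c _] := MVT_segment ut df cf.
rewrite mul0r /f subrr mulr0 expR0 mul1r => /eqP; rewrite subr_eq0 => /eqP <-.
by rewrite mulrA -expRD mulNr addrN expR0 mul1r.
Qed.

(** * Switching signals *)

(** The sequence whose next switch comes first would switch at a time at which
the other one says that the signal has not changed. *)
Lemma switching_times_uniq (R : realType) (sigma : R -> mode) (d e : nat -> R) :
  switching_times sigma d -> switching_times sigma e -> d = e.
Proof.
suff not_before (f g : nat -> R) k : switching_times sigma f ->
    switching_times sigma g -> f k = g k -> ~ f k.+1 < g k.+1.
  move=> sd se; apply/funext; elim=> [|k IH].
    by case: sd se => -> _ _ _ _ [].
  apply/eqP; rewrite eq_le !leNgt; apply/andP; split; apply/negP.
    exact: (not_before _ _ _ se sd (esym IH)).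
  exact: (not_before _ _ _ sd se IH).
move=> [_ /increasing_seqP fS _ _ fne] [_ _ _ gcst _] fg lt_fg.
by apply: (fne k); rewrite fg; apply: gcst; rewrite -fg ltW//=.
Qed.

Lemma switching_modes (R : realType) (sigma : R -> mode) (d : nat -> R) k :
  sigma 0 = mode1 -> switching_times sigma d ->
  sigma (d (2 * k)%N) = mode1 /\ sigma (d (2 * k).+1) = mode2.
Proof.
move=> s0 [d0 _ _ _ ne].
have other m1 m2 : m2 <> m1 -> m2 = match m1 with mode1 => mode2 | _ => mode1 end.
  by case: m1 m2 => [] [].
elim: k => [|k [_ IH]].
  by rewrite muln0 d0; split=> //; rewrite (other _ _ (ne 0)) d0 s0.
have E : sigma (d (2 * k.+1)%N) = mode1.
  by rewrite mulnS (other _ _ (ne (2 * k).+1)) IH.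
by split=> //; rewrite (other _ _ (ne _)) E.
Qed.

Lemma solution_between_switches (R : realType) (A : mode -> 'M[R]_2)
    (sigma : R -> mode) (d : nat -> R) (x : R -> 'cV[R]_2) k :
  switching_times sigma d -> solution A sigma x ->
  {within `[d k, d k.+1], continuous x} /\
  forall t, d k < t < d k.+1 -> is_derive t 1 x (A (sigma (d k)) *m x t).
Proof.
move=> [d0 dinc _ cst _] [cx dx].
have dk0 : 0 <= d k by rewrite -d0 dinc.
split.
  apply: continuous_subspaceW cx => s /=; rewrite !in_itv/= => /andP[ks _].
  by rewrite andbT (le_trans dk0).
move=> t /andP[kt tk].
have st : sigma t = sigma (d k) by apply: cst; rewrite ltW.
rewrite -st; apply: dx; first exact: le_lt_trans kt.
have tin : t \in `]d k, d k.+1[ by rewrite in_itv/= kt.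
have := near_in_itvoo tin; apply: filterS => s.
by rewrite in_itv/= => /andP[ks sk]; rewrite st; apply: cst; rewrite ltW.
Qed.

(** * Energy along a cycle and along the whole trajectory *)

(** Half of the logarithmic energy loss guaranteed in the k-th cycle; it measures
how far the durations of the cycle are from the critical pair (tau, eta). *)
Definition slack (R : realType) (alpha1 alpha2 tau eta : R) (d : nat -> R) k :=
  alpha1 * (on1 d k - tau) + alpha2 * (eta - on2 d k).

(** V1 and V2 stand for the two energies along a trajectory.  Each of the two
mode changes of the cycle costs a factor exp h, and the relation between tau,
eta and h is what turns the total exponent into - 2 times the slack. *)
Lemma cycle_energy (R : realType) (alpha1 alpha2 tau eta h : R) (d : nat -> R)
    (V1 V2 : R -> R) k :
  0 < alpha1 -> 0 < alpha2 -> 0 <= h ->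
  alpha1 * tau = alpha2 * eta + h ->
  {homo d : i j / (i <= j)%N >-> i <= j} -> on2 d k <= eta ->
  (forall t, 0 <= V1 t) ->
  (forall t, V1 t <= expR h * V2 t) -> (forall t, V2 t <= expR h * V1 t) ->
  (forall t, d (2 * k)%N <= t <= d (2 * k).+1 ->
     V1 t = expR (2 * - alpha1 * (t - d (2 * k)%N)) * V1 (d (2 * k)%N)) ->
  (forall t, d (2 * k).+1 <= t <= d (2 * k).+2 ->
     V2 t = expR (2 * alpha2 * (t - d (2 * k).+1)) * V2 (d (2 * k).+1)) ->
  V1 (d (2 * k.+1)%N) <=
    expR (- 2 * slack alpha1 alpha2 tau eta d k) * V1 (d (2 * k)%N) /\
  forall t, d (2 * k)%N <= t <= d (2 * k.+1)%N ->
    V1 t <= expR (2 * (h + alpha2 * eta)) * V1 (d (2 * k)%N).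
Proof.
move=> a1 a2 h0 tauE dinc on2le V1_ge0 V12 V21 E1 E2.
rewrite mulnS !add2n.
set u := d (2 * k)%N in E1 *; set v := d (2 * k).+1 in E1 E2 *.
set w := d (2 * k).+2 in E2 *.
have uv : u <= v by exact: dinc.
have vw : v <= w by exact: dinc.
have on1E : on1 d k = v - u by [].
have on2E : on2 d k = w - v by [].
have V1v : V1 v = expR (2 * - alpha1 * (v - u)) * V1 u.
  by apply: E1; rewrite uv lexx.
have V1le t : v <= t <= w ->
    V1 t <= expR (2 * h + 2 * alpha2 * (t - v) - 2 * alpha1 * (v - u)) * V1 u.
  move=> vt; apply: (le_trans (V12 t)); rewrite E2//.
  apply: (@le_trans _ _ (expR h * (expR (2 * alpha2 * (t - v)) * (expR h * V1 v)))).
    by rewrite !ler_pM2l ?expR_gt0.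
  rewrite V1v !mulrA -!expRD.
  by rewrite le_eqVlt; apply/orP; left; apply/eqP; congr (expR _ * _); ring.
have a2eta : alpha2 * (w - v) <= alpha2 * eta by rewrite ler_pM2l// -on2E.
split.
  apply: le_trans (V1le w _) _; first by rewrite vw lexx.
  rewrite le_eqVlt; apply/orP; left; apply/eqP; congr (expR _ * _).
  rewrite /slack on1E on2E; rewrite mulrDr mulrBr (mulrBr _ eta).
  by rewrite !mulrBr tauE; ring.
move=> t /andP[ut tw]; have [vt|tv] := leP v t.
  apply: le_trans (V1le t _) _; first by rewrite vt.
  rewrite ler_wpM2r// ler_expR.
  have : alpha2 * (t - v) <= alpha2 * (w - v) by rewrite ler_pM2l// lerB.
  have : 0 <= alpha1 * (v - u) by rewrite mulr_ge0 ?subr_ge0// ltW.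
  by lra.
rewrite (E1 t) ?ut ?(ltW tv)//; rewrite ler_wpM2r// ler_expR.
have : 0 <= alpha1 * (t - u) by rewrite mulr_ge0 ?subr_ge0// ltW.
have : 0 <= alpha2 * (w - v) by rewrite mulr_ge0 ?subr_ge0// ltW.
by lra.
Qed.

(** Every time lies in some cycle because the switching times are unbounded, and
the values at the starts of the cycles do not increase. *)
Lemma le_of_cycles (R : realType) (d : nat -> R) (V : R -> R) (C : R) :
  0 <= C -> d @ \oo --> +oo ->
  (forall k, V (d (2 * k.+1)%N) <= V (d (2 * k)%N)) ->
  (forall k t, d (2 * k)%N <= t <= d (2 * k.+1)%N -> V t <= C * V (d (2 * k)%N)) ->
  {homo d : i j / (i <= j)%N >-> i <= j} ->
  forall k t, d (2 * k)%N <= t -> V t <= C * V (d (2 * k)%N).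
Proof.
move=> C0 doo Vdec Vcyc dinc k t kt.
have upto n s : d (2 * k)%N <= s <= d (2 * (k + n))%N -> V s <= C * V (d (2 * k)%N).
  elim: n => [|n IH] /andP[ks sn].
    by apply: Vcyc; rewrite ks (le_trans sn)// addn0 dinc// leq_mul2l leqnSn orbT.
  have [sn'|/ltW ns] := leP s (d (2 * (k + n))%N); first by apply: IH; rewrite ks.
  apply: (le_trans (Vcyc (k + n)%N s _)); first by rewrite ns -addnS.
  apply: ler_wpM2l => //; elim: {IH sn ns} n => [|n]; first by rewrite addn0.
  by apply: le_trans; rewrite addnS.
have [N _ /(_ _ (leqnn N)) Nt] := (cvgryPge d).1 doo t.
apply: (upto N); rewrite kt (le_trans Nt)// dinc//.
by rewrite (leq_trans (leq_addl k N))// leq_pmull.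
Qed.

(** The trajectory alternates between the exact exponential laws of the two
energies, so that the estimates on a single cycle apply to each cycle. *)
Lemma switched_energy (R : realType) (alpha1 alpha2 beta1 beta2 tau eta h : R)
    (A1 A2 P1 P2 : 'M[R]_2) (sigma : R -> mode) (d : nat -> R)
    (x : R -> 'cV[R]_2) :
  0 < alpha1 -> 0 < alpha2 -> P1 \in unitmx -> P2 \in unitmx ->
  A1 = P1 *m mx22 (- alpha1) beta1 (- beta1) (- alpha1) *m invmx P1 ->
  A2 = P2 *m mx22 alpha2 beta2 (- beta2) alpha2 *m invmx P2 ->
  0 <= h -> alpha1 * tau = alpha2 * eta + h ->
  (forall v, energy P1 v <= expR h * energy P2 v) ->
  (forall v, energy P2 v <= expR h * energy P1 v) ->
  sigma 0 = mode1 -> switching_times sigma d ->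
  (forall k, tau <= on1 d k /\ on2 d k <= eta) ->
  solution (subsystem A1 A2) sigma x ->
  (forall k, energy P1 (x (d (2 * k.+1)%N)) <=
     expR (- 2 * slack alpha1 alpha2 tau eta d k) * energy P1 (x (d (2 * k)%N))) /\
  (forall k t, d (2 * k)%N <= t ->
     energy P1 (x t) <=
       expR (2 * (h + alpha2 * eta)) * energy P1 (x (d (2 * k)%N))).
Proof.
move=> a1 a2 P1u P2u A1E A2E h0 tauE V12 V21 s0 sd bnd sx.
have [_ dinc doo _ _] := sd.
have dhomo : {homo d : i j / (i <= j)%N >-> i <= j} by move=> i j; rewrite dinc.
have cyc k := cycle_energy (V1 := energy P1 \o x) (V2 := energy P2 \o x) (k := k)
  a1 a2 h0 tauE dhomo (bnd k).2 (fun t => sqnorm_ge0 _)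
  (fun t => V12 _) (fun t => V21 _).
have E1 k t : d (2 * k)%N <= t <= d (2 * k).+1 ->
    energy P1 (x t) =
      expR (2 * - alpha1 * (t - d (2 * k)%N)) * energy P1 (x (d (2 * k)%N)).
  have [cx dx] := solution_between_switches (2 * k)%N sd sx.
  rewrite (switching_modes k s0 sd).1 in dx.
  exact: energy_exp P1u A1E cx dx t.
have E2 k t : d (2 * k).+1 <= t <= d (2 * k).+2 ->
    energy P2 (x t) =
      expR (2 * alpha2 * (t - d (2 * k).+1)) * energy P2 (x (d (2 * k).+1)).
  have [cx dx] := solution_between_switches (2 * k).+1 sd sx.
  rewrite (switching_modes k s0 sd).2 in dx.
  exact: energy_exp P2u A2E cx dx t.
have {}cyc k := cyc k (E1 k) (E2 k).
split=> [k|k t kt]; first exact: (cyc k).1.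
apply: (@le_of_cycles R d (energy P1 \o x)) => //.
  move=> j; apply: le_trans (cyc j).1 _.
  rewrite ler_piMl ?sqnorm_ge0// expR_le1 mulNr oppr_le0 mulr_ge0//.
  have [b1 b2] := bnd j.
  by rewrite addr_ge0// mulr_ge0 ?subr_ge0// ltW.
by move=> j s js; exact: (cyc j).2.
Qed.

(** * Decay to zero *)

(** The limit L exists by monotonicity.  If L > 0 and q >= 0, then as soon
as v k < (2 - q) L, a contracting step leads to v k.+1 <= q (2 - q) L < L, which
is impossible; for q < 0 such a step leads to v k.+1 <= 0 < L at once. *)
Lemma cvg0_contraction (R : realType) (v : R ^nat) (q : R) :
  q < 1 -> (forall k, 0 <= v k) ->
  (forall k, v k.+1 <= v k) ->
  (forall n, exists2 k, (n <= k)%N & v k.+1 <= q * v k) ->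
  v @ \oo --> 0.
Proof.
move=> q1 v0 /nonincreasing_seqP vdec contr.
have vcv : cvgn v.
  by apply: nonincreasing_is_cvgn => //; exists 0 => _ [k _ <-].
have L0 : 0 <= limn v by apply: limr_ge => //; exact: nearW.
move: L0; rewrite le_eqVlt => /predU1P[->//|Lgt0].
exfalso.
have Lle k : limn v <= v k by exact: nonincreasing_cvgn_ge.
have e0 : 0 < (1 - q) * limn v by rewrite mulr_gt0 ?subr_gt0.
have [N _ Nv] := (cvgrPdist_lt v (limn v)).1 vcv _ e0.
have [k Nk vk] := contr N.
have := Nv k Nk; rewrite /= distrC ger0_norm ?subr_ge0// => vkL.
have := Lle k; have := Lle k.+1 => LS Lk.
have : (1 - q) ^+ 2 * limn v > 0 by rewrite mulr_gt0// exprn_gt0// subr_gt0.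
have [q0|q0] := leP 0 q.
  have : q * v k <= q * (limn v + (1 - q) * limn v) by rewrite ler_wpM2l//; lra.
  by nra.
have : q * v k <= 0 by rewrite mulr_le0_ge0// ltW.
by lra.
Qed.

(** The slack is a sum of two nonnegative terms, positive multiples of t_k - tau
and eta - s_k: if it tended to 0, both durations would converge. *)
Lemma slack_frequently_ge (R : realType) (alpha1 alpha2 tau eta : R)
    (d : nat -> R) :
  0 < alpha1 -> 0 < alpha2 ->
  (forall k, tau <= on1 d k /\ on2 d k <= eta) ->
  ~ ((on1 d k, on2 d k) @[k --> \oo] --> (tau, eta)) ->
  exists2 e, 0 < e &
    forall n, exists2 k, (n <= k)%N & e <= slack alpha1 alpha2 tau eta d k.
Proof.
move=> a1 a2 bnd ncv; apply: contrapT => none; apply: ncv.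
have small e : 0 < e -> \forall k \near \oo, slack alpha1 alpha2 tau eta d k < e.
  move=> e0; apply: contrapT => nearN; apply: none; exists e => // n.
  apply: contrapT => no; apply: nearN; exists n => // k nk /=.
  by rewrite ltNge; apply/negP => ek; apply: no; exists k.
apply: (@cvg_pair _ _ _ \oo (nbhs tau) (nbhs eta)).
  apply/cvgrPdist_lt => e e0.
  near=> k; have [b1 b2] := bnd k.
  rewrite distrC ger0_norm ?subr_ge0// -(ltr_pM2l a1).
  have : slack alpha1 alpha2 tau eta d k < alpha1 * e.
    by near: k; apply: small; rewrite mulr_gt0.
  have : 0 <= alpha2 * (eta - on2 d k) by rewrite mulr_ge0 ?subr_ge0// ltW.
  by rewrite /slack; lra.
apply/cvgrPdist_lt => e e0.
near=> k; have [b1 b2] := bnd k.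
rewrite ger0_norm ?subr_ge0// -(ltr_pM2l a2).
have : slack alpha1 alpha2 tau eta d k < alpha2 * e.
  by near: k; apply: small; rewrite mulr_gt0.
have : 0 <= alpha1 * (on1 d k - tau) by rewrite mulr_ge0 ?subr_ge0// ltW.
by rewrite /slack; lra.
Unshelve. all: by end_near. Qed.

(** * From energy bounds to stability *)

Lemma stable_of_energy (R : realType) (A : mode -> 'M[R]_2) (sigma : R -> mode)
    (P : 'M[R]_2) (C : R) :
  P \in unitmx -> 0 < C ->
  (forall x, solution A sigma x ->
     forall t, 0 <= t -> energy P (x t) <= C * energy P (x 0)) ->
  stable A sigma.
Proof.
move=> Pu C0 bnd eps eps0; have [K K0 KE] := energy_equiv Pu.
(* any L with L ^+ 2 >= K * (C * K) will do *)
pose L := K * (C * K) + 1.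
have KCK : 0 < K * (C * K) by rewrite !mulr_gt0.
have L0 : 0 < L by rewrite /L; lra.
exists (eps / L) => [|x sx x0 t t0]; first exact: divr_gt0.
have en0 (v : 'cV[R]_2) : 0 <= enorm v by exact: sqrtr_ge0.
rewrite -(ltr_pXn2r (n := 2)) ?nnegrE ?en0 ?(ltW eps0)//.
apply: le_lt_trans (KE (x t)).1 _.
apply: (@le_lt_trans _ _ (K * (C * (K * enorm (x 0) ^+ 2)))).
  rewrite ler_pM2l//; apply: le_trans (bnd _ sx _ (ltW t0)) _.
  by rewrite ler_pM2l//; exact: (KE _).2.
apply: (@le_lt_trans _ _ (L ^+ 2 * enorm (x 0) ^+ 2)).
  have -> : K * (C * (K * enorm (x 0) ^+ 2)) = K * (C * K) * enorm (x 0) ^+ 2.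
    by ring.
  by apply: ler_wpM2r; [exact: sqr_ge0|rewrite /L; nra].
rewrite -exprMn ltr_pXn2r ?nnegrE ?mulr_ge0 ?en0 ?(ltW L0) ?(ltW eps0)//.
by rewrite mulrC -ltr_pdivlMr.
Qed.

Lemma enorm_cvg0 (R : realType) (P : 'M[R]_2) (x : R -> 'cV[R]_2) :
  P \in unitmx ->
  (forall e : R, 0 < e -> exists T, forall t, T <= t -> energy P (x t) <= e) ->
  enorm (x t) @[t --> +oo] --> 0.
Proof.
move=> Pu small; have [K K0 KE] := energy_equiv Pu.
apply/cvgr0Pnorm_le => e e0.
have [|T ET] := small (e ^+ 2 / K); first by rewrite divr_gt0// exprn_gt0.
near=> t.
have en0 : 0 <= enorm (x t) by exact: sqrtr_ge0.
rewrite ger0_norm// -(ler_pXn2r (n := 2)) ?nnegrE ?en0 ?(ltW e0)//.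
apply: le_trans (KE (x t)).1 _.
rewrite -ler_pdivlMl// mulrC; apply: ET.
near: t; apply: nbhs_pinfty_ge; exact: num_real.
Unshelve. all: by end_near. Qed.

Theorem theorem12p1 (R : realType) (alpha1 alpha2 beta1 beta2 : R)
    (A1 A2 P1 P2 : 'M[R]_2) (a b c d eta : R)
    (halpha1 : 0 < alpha1) (halpha2 : 0 < alpha2)
    (hbeta1 : beta1 <> 0) (hbeta2 : beta2 <> 0)
    (hP1 : P1 \in unitmx) (hP2 : P2 \in unitmx)
    (hA1 : A1 = P1 *m mx22 (- alpha1) beta1 (- beta1) (- alpha1) *m invmx P1)
    (hA2 : A2 = P2 *m mx22 alpha2 beta2 (- beta2) alpha2 *m invmx P2)
    (hM : invmx P2 *m P1 = mx22 a b c d)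
    (hdet : \det (invmx P2 *m P1) = 1 \/ \det (invmx P2 *m P1) = -1)
    (heta : 0 < eta) :
  (forall sigma : R -> mode,
      signals (tau12 alpha1 alpha2 a b c d eta) eta sigma ->
      stable (subsystem A1 A2) sigma) /\
  (forall sigma : R -> mode,
      signals' (tau12 alpha1 alpha2 a b c d eta) eta sigma ->
      asymptotically_stable (subsystem A1 A2) sigma).
Proof.
have det1 : \det (mx22 a b c d) ^+ 2 = 1.
  by rewrite -hM; case: hdet => ->; rewrite ?sqrrN expr1n.
have [] := energy_transition_le hP1 hM det1.
set h := arcosh _; set tau := tau12 _ _ _ _ _ _ _ => h0 V12 V21.
have tauE : alpha1 * tau = alpha2 * eta + h.
  by rewrite /tau /tau12 -/h; field; rewrite gt_eqF.
have bound sigma e x : sigma 0 = mode1 -> switching_times sigma e -> _ :=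
  fun s0 se => @switched_energy R alpha1 alpha2 beta1 beta2 tau eta h A1 A2 P1 P2
    sigma e x halpha1 halpha2 hP1 hP2 hA1 hA2 h0 tauE V12 V21 s0 se.
have stab sigma : signals tau eta sigma -> stable (subsystem A1 A2) sigma.
  move=> [s0 [e se be]].
  apply: (@stable_of_energy _ _ _ P1 (expR (2 * (h + alpha2 * eta)))) => //.
    exact: expR_gt0.
  move=> x sx t t0; have [_] := bound _ _ _ s0 se be sx.
  by have [e0 _ _ _ _] := se; move=> /(_ 0%N t); rewrite muln0 e0; exact.
split=> // sigma [sig [e' se' ncv]]; split=> [|x sx]; first exact: stab.
have [s0 [e se be]] := sig.
rewrite (switching_times_uniq se' se) in ncv.
have [step le_after] := bound _ _ _ s0 se be sx.
have slack_ge0 k : 0 <= slack alpha1 alpha2 tau eta e k.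
  by have [b1 b2] := be k; rewrite addr_ge0// mulr_ge0 ?subr_ge0// ltW.
have [g g0 often] := slack_frequently_ge halpha1 halpha2 be ncv.
have v0 k : 0 <= energy P1 (x (e (2 * k)%N)) by exact: sqnorm_ge0.
have vcv : energy P1 (x (e (2 * k)%N)) @[k --> \oo] --> 0.
  apply: (@cvg0_contraction _ _ (expR (- 2 * g))) => //.
  - by rewrite expR_lt1 mulNr oppr_lt0 mulr_gt0.
  - move=> k; apply: le_trans (step k) _.
    by rewrite ler_piMl// expR_le1 mulNr oppr_le0 mulr_ge0.
  - move=> n; have [k nk gk] := often n; exists k => //.
    apply: le_trans (step k) _; rewrite ler_wpM2r// ler_expR.
    by rewrite !mulNr lerN2 ler_pM2l.
apply: (enorm_cvg0 hP1) => eps eps0.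
have C0 := expR_gt0 (2 * (h + alpha2 * eta)); set C := expR _ in C0 le_after.
have [N _ /(_ _ (leqnn N)) /=] :=
  (cvgr0Pnorm_le (fun k => energy P1 (x (e (2 * k)%N)))).1 vcv _ (divr_gt0 eps0 C0).
rewrite ger0_norm// => vN.
exists (e (2 * N)%N) => t Nt.
by apply: le_trans (le_after N t Nt) _; rewrite -ler_pdivlMl// mulrC.
Qed.
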